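(* The Novikov algebra $(T,D)$ is isomorphic to $\mathcal{N}(\mathfrak{L})$, the free (left-)Novikov algebra over the set $\mathfrak{L}$.
   Context: The base field is $\mathbb{R}$. $\mathfrak{L}$ is a finite set and $\mathbb{N}_0=\{0,1,\dots\}$. $M(\mathfrak{L}\times\mathbb{N}_0)$ is the set of finitely supported functions $\beta:\mathfrak{L}\times\mathbb{N}_0\to\mathbb{N}_0$; $\mathsf{z}^\beta=\prod\mathsf{z}_{(\mathfrak{l},k)}^{\beta(\mathfrak{l},k)}$ are monomials in commuting variables $\mathsf{z}_{(\mathfrak{l},k)}$; $[\beta]=\sum_{(\mathfrak{l},k)}(1-k)\beta(\mathfrak{l},k)$; $T=\mathrm{span}\{\mathsf{z}^\beta:\beta\in M(\mathfrak{L}\times\mathbb{N}_0),\,[\beta]=1\}$. $D=\sum_{(\mathfrak{l},k)}(k+1)\mathsf{z}_{(\mathfrak{l},k+1)}\partial_{\mathsf{z}_{(\mathfrak{l},k)}}$ is a derivation of the polynomial algebra; $(T,D)$ denotes $T$ equipped with the product $(\pi,\pi')\mapsto\pi\cdot(D\pi')$, under which $T$ is closed. A (left-)Novikov algebra is a vector space $L$ with bilinear product $\triangleright$ satisfying, for all $a,b,c$, the pre-Lie identity $a\triangleright(b\triangleright c)-(a\triangleright b)\triangleright c=b\triangleright(a\triangleright c)-(b\triangleright a)\triangleright c$ and $(a\triangleright b)\triangleright c=(a\triangleright c)\triangleright b$. *)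

(* Defs.v *)
From HB Require Import structures.
From mathcomp Require Import all_boot all_order all_algebra.
From mathcomp Require Import finmap generic_quotient.
From mathcomp Require Import boolp classical_sets fsbigop reals.
From mathcomp Require Import zify.
From mathcomp.multinomials Require Import monalg.

Set Implicit Arguments.
Unset Strict Implicit.
Unset Printing Implicit Defensive.

Import Order.TTheory GRing.Theory Num.Theory.

Local Open Scope ring_scope.

Reserved Notation "a ▷ b" (at level 40, left associativity).

HB.mixin Record Lmodule_isNovikov (R : comNzRingType) L of GRing.Lmodule R L := {
  nov : L -> L -> L;
  nov_linearl : forall b, linear (nov^~ b);
  nov_linearr : forall a, linear (nov a);
  nov_prelie : forall a b c,
    nov a (nov b c) - nov (nov a b) c = nov b (nov a c) - nov (nov b a) c;
  nov_rcomm : forall a b c, nov (nov a b) c = nov (nov a c) b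
}.

#[short(type="novikovType")]
HB.structure Definition Novikov (R : comNzRingType) :=
  {L of Lmodule_isNovikov R L & GRing.Lmodule R L}.

Notation "a ▷ b" := (nov a b) : ring_scope.

Definition novikov_morph (R : comNzRingType) (A B : novikovType R)
    (f : {linear A -> B}) : Prop :=
  {morph f : a b / a ▷ b}.

Definition novikov_iso (R : comNzRingType) (A B : novikovType R) : Prop :=
  exists f : {linear A -> B}, novikov_morph f /\ bijective f.

Definition is_free_novikov (R : comNzRingType) (S : Type) (N : novikovType R)
    (i : S -> N) : Prop :=
  forall (A : novikovType R) (g : S -> A),
    exists f : {linear N -> A},
      [/\ novikov_morph f, forall s, f (i s) = g s
        & forall h : {linear N -> A}, novikov_morph h ->
            (forall s, h (i s) = g s) -> h =1 f].

(** Formal expressions in the generators and the operations of a Novikov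
    algebra, modulo the congruence generated by the axioms of Novikov
    algebras. [free_novikovP] below is the universal property. *)

Section FreeNovikov.
Variables (R : comNzRingType) (S : Type).

Inductive nterm : Type :=
| NGen of S
| NZero
| NAdd of nterm & nterm
| NOpp of nterm
| NScale of R & nterm
| NMul of nterm & nterm.

HB.instance Definition _ := gen_eqMixin nterm.
HB.instance Definition _ := gen_choiceMixin nterm.

Inductive nov_eq : nterm -> nterm -> Prop :=
| NE_refl a : nov_eq a a
| NE_sym a b : nov_eq a b -> nov_eq b a
| NE_trans a b c : nov_eq a b -> nov_eq b c -> nov_eq a c
| NE_add a a' b b' :
    nov_eq a a' -> nov_eq b b' -> nov_eq (NAdd a b) (NAdd a' b')
| NE_opp a a' : nov_eq a a' -> nov_eq (NOpp a) (NOpp a')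
| NE_scale r a a' : nov_eq a a' -> nov_eq (NScale r a) (NScale r a')
| NE_mul a a' b b' :
    nov_eq a a' -> nov_eq b b' -> nov_eq (NMul a b) (NMul a' b')
| NE_addA a b c : nov_eq (NAdd a (NAdd b c)) (NAdd (NAdd a b) c)
| NE_addC a b : nov_eq (NAdd a b) (NAdd b a)
| NE_add0 a : nov_eq (NAdd NZero a) a
| NE_addN a : nov_eq (NAdd (NOpp a) a) NZero
| NE_scaleA r s a : nov_eq (NScale r (NScale s a)) (NScale (r * s) a)
| NE_scale1 a : nov_eq (NScale 1 a) a
| NE_scaleDr r a b :
    nov_eq (NScale r (NAdd a b)) (NAdd (NScale r a) (NScale r b))
| NE_scaleDl r s a :
    nov_eq (NScale (r + s) a) (NAdd (NScale r a) (NScale s a))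
| NE_mulDl a b c : nov_eq (NMul (NAdd a b) c) (NAdd (NMul a c) (NMul b c))
| NE_mulDr a b c : nov_eq (NMul a (NAdd b c)) (NAdd (NMul a b) (NMul a c))
| NE_mulZl r a b : nov_eq (NMul (NScale r a) b) (NScale r (NMul a b))
| NE_mulZr r a b : nov_eq (NMul a (NScale r b)) (NScale r (NMul a b))
| NE_prelie a b c :
    nov_eq (NAdd (NMul a (NMul b c)) (NOpp (NMul (NMul a b) c)))
           (NAdd (NMul b (NMul a c)) (NOpp (NMul (NMul b a) c)))
| NE_rcomm a b c : nov_eq (NMul (NMul a b) c) (NMul (NMul a c) b).

Definition nov_eqb (a b : nterm) : bool := `[< nov_eq a b >].

Lemma nov_eqb_equiv : equiv_class_of nov_eqb.
Proof.
split=> [a|a b|b a c].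
- by apply/asboolP; exact: NE_refl.
- by apply/asboolP/asboolP; exact: NE_sym.
- by move=> /asboolP ab /asboolP bc; apply/asboolP; exact: NE_trans ab bc.
Qed.

Canonical nov_eqb_equiv_rel := EquivRelPack nov_eqb_equiv.

Local Open Scope quotient_scope.

Definition freeNovikov : Type := {eq_quot nov_eqb}.

HB.instance Definition _ := Choice.on freeNovikov.
HB.instance Definition _ := EqQuotient.on freeNovikov.

Local Notation cls := (\pi_freeNovikov).

Definition fn_gen (s : S) : freeNovikov := cls (NGen s).

(* The operations are locked so that rewriting does not unfold them. *)
Local Definition fn_add : freeNovikov -> freeNovikov -> freeNovikov :=
  locked (fun a b => cls (NAdd (repr a) (repr b))).
Local Definition fn_opp : freeNovikov -> freeNovikov :=
  locked (fun a => cls (NOpp (repr a))).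
Local Definition fn_scale : R -> freeNovikov -> freeNovikov :=
  locked (fun r a => cls (NScale r (repr a))).
Local Definition fn_mul : freeNovikov -> freeNovikov -> freeNovikov :=
  locked (fun a b => cls (NMul (repr a) (repr b))).

Lemma fn_piP a b : nov_eq a b <-> cls a = cls b.
Proof.
split=> [ab|/eqmodP/asboolP//].
by apply/eqmodP/asboolP.
Qed.

Let repr_pi a : nov_eq (repr (cls a)) a.
Proof. by apply/fn_piP; rewrite reprK. Qed.

Let addE a b : fn_add (cls a) (cls b) = cls (NAdd a b).
Proof. by rewrite /fn_add -lock; apply/fn_piP; apply: NE_add. Qed.
Let oppE a : fn_opp (cls a) = cls (NOpp a).
Proof. by rewrite /fn_opp -lock; apply/fn_piP; apply: NE_opp. Qed.
Let scaleE r a : fn_scale r (cls a) = cls (NScale r a).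
Proof. by rewrite /fn_scale -lock; apply/fn_piP; apply: NE_scale. Qed.
Let mulE a b : fn_mul (cls a) (cls b) = cls (NMul a b).
Proof. by rewrite /fn_mul -lock; apply/fn_piP; apply: NE_mul. Qed.

Let addA : associative fn_add.
Proof.
by elim/quotW=> a; elim/quotW=> b; elim/quotW=> c; rewrite !addE;
  apply/fn_piP; exact: NE_addA.
Qed.
Let addC : commutative fn_add.
Proof.
by elim/quotW=> a; elim/quotW=> b; rewrite !addE; apply/fn_piP; exact: NE_addC.
Qed.
Let add0 : left_id (cls NZero) fn_add.
Proof. by elim/quotW=> a; rewrite addE; apply/fn_piP; exact: NE_add0. Qed.
Let addN : left_inverse (cls NZero) fn_opp fn_add.
Proof. by elim/quotW=> a; rewrite oppE addE; apply/fn_piP; exact: NE_addN. Qed.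

HB.instance Definition _ :=
  GRing.isZmodule.Build freeNovikov addA addC add0 addN.

Let scaleA r s a : fn_scale r (fn_scale s a) = fn_scale (r * s) a.
Proof.
by elim/quotW: a => a; rewrite !scaleE; apply/fn_piP; exact: NE_scaleA.
Qed.
Let scale1 : left_id 1 fn_scale.
Proof. by elim/quotW=> a; rewrite scaleE; apply/fn_piP; exact: NE_scale1. Qed.
Let scaleDr : right_distributive fn_scale +%R.
Proof.
move=> r; elim/quotW=> a; elim/quotW=> b.
by rewrite -[LHS]/(fn_scale r (fn_add _ _)) -[RHS]/(fn_add _ _)
  !(addE, scaleE); apply/fn_piP; exact: NE_scaleDr.
Qed.
Let scaleDl a : {morph fn_scale^~ a : r s / r + s}.
Proof.
move=> r s; elim/quotW: a => a /=; rewrite -[RHS]/(fn_add _ _).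
by rewrite !(addE, scaleE); apply/fn_piP; exact: NE_scaleDl.
Qed.

HB.instance Definition _ := GRing.Zmodule_isLmodule.Build R freeNovikov
  scaleA scale1 scaleDr scaleDl.

Let piD a b : cls a + cls b = cls (NAdd a b).
Proof. exact: addE. Qed.
Let piN a : - cls a = cls (NOpp a).
Proof. exact: oppE. Qed.
Let piZ r a : r *: cls a = cls (NScale r a).
Proof. exact: scaleE. Qed.
Let piE := (piD, piN, piZ, mulE).

Let mul_linearl b : linear (fn_mul^~ b).
Proof.
move=> r; elim/quotW=> a; elim/quotW=> a'; elim/quotW: b => b.
rewrite !piE; apply/fn_piP; apply: NE_trans (NE_mulDl _ _ _) _.
by apply: NE_add (NE_mulZl _ _ _) (NE_refl _).
Qed.
Let mul_linearr a : linear (fn_mul a).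
Proof.
move=> r; elim/quotW=> b; elim/quotW=> b'; elim/quotW: a => a.
rewrite !piE; apply/fn_piP; apply: NE_trans (NE_mulDr _ _ _) _.
by apply: NE_add (NE_mulZr _ _ _) (NE_refl _).
Qed.
Let mul_prelie a b c : fn_mul a (fn_mul b c) - fn_mul (fn_mul a b) c =
  fn_mul b (fn_mul a c) - fn_mul (fn_mul b a) c.
Proof.
elim/quotW: a => a; elim/quotW: b => b; elim/quotW: c => c.
by rewrite !piE; apply/fn_piP; exact: NE_prelie.
Qed.
Let mul_rcomm a b c : fn_mul (fn_mul a b) c = fn_mul (fn_mul a c) b.
Proof.
elim/quotW: a => a; elim/quotW: b => b; elim/quotW: c => c.
by rewrite !piE; apply/fn_piP; exact: NE_rcomm.
Qed.

HB.instance Definition _ := Lmodule_isNovikov.Build R freeNovikov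
  mul_linearl mul_linearr mul_prelie mul_rcomm.

Let piM a b : cls a ▷ cls b = cls (NMul a b).
Proof. exact: mulE. Qed.

Fixpoint nterm_eval (A : novikovType R) (g : S -> A) (a : nterm) : A :=
  match a with
  | NGen s => g s
  | NZero => 0
  | NAdd a b => nterm_eval g a + nterm_eval g b
  | NOpp a => - nterm_eval g a
  | NScale r a => r *: nterm_eval g a
  | NMul a b => nterm_eval g a ▷ nterm_eval g b
  end.

Lemma nterm_eval_eq (A : novikovType R) (g : S -> A) a b :
  nov_eq a b -> nterm_eval g a = nterm_eval g b.
Proof.
have lDl (u v w : A) : (u + v) ▷ w = u ▷ w + v ▷ w.
  by have := nov_linearl w 1 u v; rewrite !scale1r.
have lDr (u v w : A) : u ▷ (v + w) = u ▷ v + u ▷ w.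
  by have := nov_linearr u 1 v w; rewrite !scale1r.
have l0l (w : A) : 0 ▷ w = 0.
  by apply: (addrI (0 ▷ w)); rewrite -lDl !addr0.
have l0r (w : A) : w ▷ 0 = 0.
  by apply: (addrI (w ▷ 0)); rewrite -lDr !addr0.
elim=> //=.
- by move=> ? ? ? _ -> _ ->.
- by move=> ? ? ? ? _ -> _ ->.
- by move=> ? ? _ ->.
- by move=> ? ? ? _ ->.
- by move=> ? ? ? ? _ -> _ ->.
- by move=> *; rewrite addrA.
- by move=> *; rewrite addrC.
- by move=> *; rewrite add0r.
- by move=> *; rewrite addNr.
- by move=> *; rewrite scalerA.
- by move=> *; rewrite scale1r.
- by move=> *; rewrite scalerDr.
- by move=> *; rewrite scalerDl.
- move=> r u v; have := nov_linearl (nterm_eval g v) r (nterm_eval g u) 0.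
  by rewrite !addr0 l0l addr0.
- move=> r u v; have := nov_linearr (nterm_eval g u) r (nterm_eval g v) 0.
  by rewrite !addr0 l0r addr0.
- by move=> *; exact: nov_prelie.
- by move=> *; exact: nov_rcomm.
Qed.

Theorem free_novikovP : is_free_novikov (fn_gen : S -> freeNovikov).
Proof.
move=> A g; pose F (x : freeNovikov) : A := nterm_eval g (repr x).
have Fpi a : F (cls a) = nterm_eval g a by apply: nterm_eval_eq.
have Flin : linear F.
  by move=> r; elim/quotW=> a; elim/quotW=> b; rewrite !piE !Fpi.
pose FM := GRing.isLinear.Build R freeNovikov A _ F Flin.
pose f : {linear freeNovikov -> A} := HB.pack F FM.
exists f; split=> [|s|h hM hg].
- by elim/quotW=> a; elim/quotW=> b; rewrite /= piM !Fpi.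
- by rewrite /= Fpi.
elim/quotW; rewrite /=; elim=> [s||a IHa b IHb|a IHa|r a IHa|a IHa b IHb];
  rewrite Fpi /= -?Fpi.
- exact: hg.
- by rewrite -[cls NZero]/(0 : freeNovikov) linear0.
- by rewrite -piD linearD IHa IHb.
- by rewrite -piN linearN IHa.
- by rewrite -piZ linearZ IHa.
- by rewrite -piM hM IHa IHb.
Qed.

End FreeNovikov.

(* These are stated over an abstract ring because some conversion problems on
   [malg] are intractable. *)
Lemma leibnizDl (A : comNzRingType) (d : A -> A) p1 p2 q :
  {morph d : x y / x + y} ->
  d (p1 * q) = d p1 * q + p1 * d q -> d (p2 * q) = d p2 * q + p2 * d q ->
  d ((p1 + p2) * q) = d (p1 + p2) * q + (p1 + p2) * d q.
Proof. by move=> dD h1 h2; rewrite mulrDl !dD h1 h2 !mulrDl addrACA. Qed.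

Lemma leibnizDr (A : comNzRingType) (d : A -> A) p q1 q2 :
  {morph d : x y / x + y} ->
  d (p * q1) = d p * q1 + p * d q1 -> d (p * q2) = d p * q2 + p * d q2 ->
  d (p * (q1 + q2)) = d p * (q1 + q2) + p * d (q1 + q2).
Proof. by move=> dD h1 h2; rewrite mulrDr !dD h1 h2 !mulrDr addrACA. Qed.

Lemma scale_mul_linear (R : comNzRingType) (A : comAlgType R) (r n : R)
    (z u v : A) :
  r *: (n *: (z * u)) + n *: (z * v) = n *: (z * (r *: u + v)).
Proof. by rewrite mulrDr -scalerAr scalerDr !scalerA [r * n]mulrC. Qed.

Lemma scale_mul_leibniz (R : comNzRingType) (A : comAlgType R) (n : R)
    (z p q u v : A) :
  n *: (z * u) * q + p * (n *: (z * v)) = n *: (z * (u * q + p * v)).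
Proof.
by rewrite mulrDr scalerDr -scalerAl mulrA -scalerAr [p * (z * v)]mulrCA.
Qed.

Lemma mul_linear_l (R : comNzRingType) (A : comAlgType R) (r : R)
    (u v w : A) :
  (r *: u + v) * w = r *: (u * w) + v * w.
Proof. by rewrite mulrDl scalerAl. Qed.

Lemma mul_linear_r (R : comNzRingType) (A : comAlgType R) (r : R)
    (u v w : A) :
  w * (r *: u + v) = r *: (w * u) + w * v.
Proof. by rewrite mulrDr scalerAr. Qed.

Lemma deriv_prelie (A : comNzRingType) (d : A -> A) :
  (forall p q, d (p * q) = d p * q + p * d q) ->
  forall a b c,
    a * d (b * d c) - a * d b * d c = b * d (a * d c) - b * d a * d c.
Proof.
by move=> dM a b c; rewrite !dM !mulrDr !mulrA [LHS]addrC addKr [RHS]addrC addKr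
  [a * b]mulrC.
Qed.

Section NovikovPoly.
Variables (R : comNzRingType) (L : choiceType).

(* The variable z_(l,k) is the pair (l, k). *)
Local Notation var := (L * nat)%type.
Local Notation mon := {cmonom var}.
Local Notation pol := {malg R[mon]}.
Local Notation "'Z_' x" := (<< ucm x >> : pol) (at level 8, x at level 2).

Definition bracket (b : mon) : int :=
  \sum_(x <- finsupp b) (1 - x.2%:Z) * (b x)%:Z.

(* If [b x = 0] then [divcm b (ucm x)] is junk, but its coefficient is 0. *)
Definition pderiv (x : var) (p : pol) : pol :=
  \sum_(b <- msupp p) << p@_b *+ b x *g divcm b (ucm x) >>.

(* Only finitely many summands are nonzero: see [pderiv_out]. *)
Definition polD (p : pol) : pol :=
  \sum_(x \in [set: var]) x.2.+1%:R *: (Z_ (x.1, x.2.+1) * pderiv x p).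

(* [polT] is the span of the monomials [b] with [bracket b = 1]: a polynomial
   is in it when its monomials are all of this kind, cf. [polT_spanP]. *)
Definition polT_pred (p : pol) : bool :=
  all (fun b => bracket b == 1) (msupp p).

Record polT : Type := PolT { polT_val :> pol; _ : polT_pred polT_val }.

HB.instance Definition _ := [isSub for polT_val].
HB.instance Definition _ := [Choice of polT by <:].

Lemma bracketE (d : {fset var}) (b : mon) : (finsupp b `<=` d)%fset ->
  bracket b = \sum_(x <- d) (1 - x.2%:Z) * (b x)%:Z.
Proof.
move=> bd; rewrite /bracket (big_fset_incl _ bd)//= => x _.
by rewrite -cmE_eq0 => /eqP ->; rewrite mulr0.
Qed.

Lemma bracketM b c : bracket (mmul b c) = bracket b + bracket c.
Proof.
have sub (d : mon) : (d = b \/ d = c \/ d = mmul b c) ->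
    (finsupp d `<=` finsupp (mmul b c))%fset.
  by move=> [|[|]] ->; rewrite // mdomD ?fsubsetUl ?fsubsetUr.
rewrite !(@bracketE (finsupp (mmul b c))) ?sub//; [|by auto..].
rewrite -big_split; apply: eq_bigr => x _ /=.
by rewrite cmM PoszD mulrDr.
Qed.

Lemma bracketU x : bracket (ucm x) = 1 - x.2%:Z.
Proof.
by rewrite /bracket mdomU big_seq_fset1 cmUU mulr1.
Qed.

Definition homog (n : int) (p : pol) : Prop :=
  forall b, p@_b != 0 -> bracket b = n.

Lemma polT_predP p : reflect (homog 1 p) (polT_pred p).
Proof.
apply: (iffP allP) => [h b|h b].
  by rewrite mcoeff_neq0 => /h/eqP.
by rewrite -mcoeff_neq0 => /h ->.
Qed.

Lemma homog0 n : homog n 0.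
Proof. by move=> b; rewrite mcoeff0 eqxx. Qed.

Lemma homogD n p q : homog n p -> homog n q -> homog n (p + q).
Proof.
move=> hp hq b; rewrite mcoeffD.
have [->|/hp//] := eqVneq (p@_b) 0; rewrite add0r; exact: hq.
Qed.

Lemma homogZ n r p : homog n p -> homog n (r *: p).
Proof.
move=> hp b; rewrite mcoeffZ => h; apply: hp; apply: contra_neq h => ->.
by rewrite mulr0.
Qed.

Lemma homogU n r b : bracket b = n -> homog n << r *g b >>.
Proof.
by move=> <- c; rewrite mcoeffU; case: (b =P c) => [->//|]; rewrite mulr0n eqxx.
Qed.

Lemma homog_sum n I (s : seq I) (P : pred I) (F : I -> pol) :
  (forall i, P i -> homog n (F i)) -> homog n (\sum_(i <- s | P i) F i).
Proof. by move=> h; elim/big_ind: _ => //; [exact: homog0|exact: homogD]. Qed.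

Lemma homog_supp n p b : homog n p -> b \in msupp p -> bracket b = n.
Proof. by move=> hp; rewrite -mcoeff_neq0; exact: hp. Qed.

Lemma homogM m n p q : homog m p -> homog n q -> homog (m + n) (p * q).
Proof.
move=> hp hq; rewrite malgME big_seq; apply: homog_sum => b bp.
rewrite big_seq; apply: homog_sum => c cq; apply: homogU.
by rewrite bracketM (homog_supp hp bp) (homog_supp hq cq).
Qed.

Lemma homog_pderiv n x p :
  homog n p -> homog (n - (1 - x.2%:Z)) (pderiv x p).
Proof.
move=> hp; rewrite /pderiv big_seq; apply: homog_sum => b bp.
have [b0|bx] := eqVneq (b x) 0%N.
  by rewrite b0 mulr0n monalgU0; exact: homog0.
apply: homogU; rewrite -(homog_supp hp bp).
suff {2}-> : b = mmul (divcm b (ucm x)) (ucm x).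
  by rewrite bracketM bracketU addrK.
apply/eqP/cmP => y; rewrite cmM divcmE ucmE.
by case: eqP => [<-|_]; rewrite ?subnK ?lt0n// subn0 addn0.
Qed.

Lemma homog_polD n p : homog n p -> homog (n - 1) (polD p).
Proof.
move=> hp; apply: homog_sum => x _; apply: homogZ.
have -> : n - 1 = (1 - x.2.+1%:Z) + (n - (1 - x.2%:Z)).
  by rewrite -addn1 PoszD opprD opprB !addrA; lia.
by apply: homogM; [apply: homogU; rewrite bracketU|exact: homog_pderiv].
Qed.

Lemma pderivEw (d : {fset mon}) x p : (msupp p `<=` d)%fset ->
  pderiv x p = \sum_(b <- d) << p@_b *+ b x *g divcm b (ucm x) >>.
Proof.
move=> pd; rewrite /pderiv (big_fset_incl _ pd)//= => b _ bp.
by rewrite mcoeff_outdom// mul0rn monalgU0.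
Qed.

Lemma malgZU r s b : r *: (<< s *g b >> : pol) = << r * s *g b >>.
Proof.
apply/malgP => c; apply: etrans (esym (mcoeffU _ _ _)).
by rewrite mcoeffZ mcoeffU mulrnAr.
Qed.

Lemma pderiv_linear x : linear (pderiv x).
Proof.
move=> r p q; set d := (msupp (r *: p + q) `|` (msupp p `|` msupp q))%fset.
rewrite !(@pderivEw d); first last.
- by rewrite fsubsetUl.
- by rewrite /d fsubsetU// fsubsetUl orbT.
- by rewrite /d fsubsetU// fsubsetUr orbT.
rewrite scaler_sumr -big_split; apply: eq_bigr => b _ /=.
by rewrite malgZU mcoeffD mcoeffZ mulrnDl monalgUD mulrnAr.
Qed.

HB.instance Definition _ x :=
  GRing.isLinear.Build R pol pol _ (pderiv x) (pderiv_linear x).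

Lemma pderivU x r b :
  pderiv x << r *g b >> = << r *+ b x *g divcm b (ucm x) >>.
Proof.
rewrite (@pderivEw [fset b]%fset) ?msuppU_le// big_seq_fset1.
by rewrite mcoeffUU.
Qed.

Lemma pderiv_var x y : pderiv x (Z_ y) = (x == y)%:R.
Proof.
rewrite pderivU ucmE eq_sym; case: eqP => [->|_]; last exact: monalgU0.
rewrite (_ : divcm _ _ = mone)//; apply/eqP/cmP => z.
by rewrite divcmE subnn onecmE.
Qed.

Lemma malgUU r s b c :
  (<< r *g b >> : pol) * << s *g c >> = << r * s *g mmul b c >>.
Proof. by rewrite malgM_def fgmulUU. Qed.

Lemma divcmM (x : var) (u v : mon) : u x != 0%N ->
  divcm (mmul u v) (ucm x) = mmul (divcm u (ucm x)) v.
Proof.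
move=> ux; apply/eqP/cmP => y; rewrite divcmE !cmM divcmE ucmE.
by case: eqP => [<-|_]; rewrite ?subn0// addnBAC// lt0n.
Qed.

Lemma divcmMr (x : var) (u v : mon) : v x != 0%N ->
  divcm (mmul u v) (ucm x) = mmul u (divcm v (ucm x)).
Proof. by move=> vx; rewrite (mulmC u v) divcmM// mulmC. Qed.

Lemma pderivUM x r s b c : let p : pol := << r *g b >> in
  let q : pol := << s *g c >> in
  pderiv x (p * q) = pderiv x p * q + p * pderiv x q.
Proof.
move=> p q.
have -> : pderiv x p * q = << (r *+ b x) * s *g mmul (divcm b (ucm x)) c >>.
  by rewrite pderivU malgUU.
have -> : p * pderiv x q = << r * (s *+ c x) *g mmul b (divcm c (ucm x)) >>.
  by rewrite pderivU malgUU.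
have -> : p * q = << r * s *g mmul b c >> by rewrite malgUU.
rewrite {p q} pderivU cmM mulrnDr monalgUD mulrnAl mulrnAr.
apply: (congr2 +%R).
  have [->|bx] := eqVneq (b x) 0%N; first by rewrite !mulr0n !monalgU0.
  by rewrite divcmM.
have [->|cx] := eqVneq (c x) 0%N; first by rewrite !mulr0n !monalgU0.
by rewrite divcmMr.
Qed.

Lemma pderivM x p q : pderiv x (p * q) = pderiv x p * q + p * pderiv x q.
Proof.
have dD : {morph pderiv x : u v / u + v} := linearD (pderiv x).
have d0 : pderiv x 0 = 0 := linear0 (pderiv x).
rewrite [p]monalgE; elim/big_ind: _ => [|p1 p2|b _].
- by rewrite mul0r d0 !mul0r addr0.
- exact: leibnizDl.
rewrite [q]monalgE; elim/big_ind: _ => [|q1 q2|c _].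
- by rewrite mulr0 d0 !mulr0 addr0.
- exact: leibnizDr.
exact: pderivUM.
Qed.

Definition pvars (p : pol) : {fset var} :=
  (\bigcup_(b <- msupp p) finsupp b)%fset.

Lemma pderiv_out x p : x \notin pvars p -> pderiv x p = 0.
Proof.
move=> xp; rewrite /pderiv big_seq big1// => b bp.
suff /eqP -> : b x == 0%N by rewrite mulr0n monalgU0.
rewrite cmE_eq0; apply: contra xp => xb.
by apply/bigfcupP; exists b; rewrite ?bp.
Qed.

Lemma polDE (d : {fset var}) p : (forall x, x \notin d -> pderiv x p = 0) ->
  polD p = \sum_(x <- d) x.2.+1%:R *: (Z_ (x.1, x.2.+1) * pderiv x p).
Proof.
move=> h; apply: fsbigTE => x /h ->.
by rewrite mulr0 scaler0.
Qed.

Lemma polD_linear : linear polD.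
Proof.
move=> r p q; set d := (pvars p `|` pvars q)%fset.
have hp x : x \notin d -> pderiv x p = 0.
  by rewrite inE negb_or => /andP[/pderiv_out].
have hq x : x \notin d -> pderiv x q = 0.
  by rewrite inE negb_or => /andP[_ /pderiv_out].
have hr x : x \notin d -> pderiv x (r *: p + q) = 0.
  by move=> xd; rewrite linearP /= hp// hq// scaler0 addr0.
apply: etrans (polDE hr) _; symmetry.
apply: etrans (congr2 (fun u v => r *: u + v) (polDE hp) (polDE hq)) _.
rewrite scaler_sumr -big_split; apply: eq_bigr => x _ /=.
by rewrite [in RHS]pderiv_linear; exact: scale_mul_linear.
Qed.

HB.instance Definition _ := GRing.isLinear.Build R pol pol _ polD polD_linear.

Lemma polDM p q : polD (p * q) = polD p * q + p * polD q.
Proof.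
set d := (pvars p `|` pvars q)%fset.
have hp x : x \notin d -> pderiv x p = 0.
  by rewrite inE negb_or => /andP[/pderiv_out].
have hq x : x \notin d -> pderiv x q = 0.
  by rewrite inE negb_or => /andP[_ /pderiv_out].
have hr x : x \notin d -> pderiv x (p * q) = 0.
  by move=> xd; rewrite pderivM hp// hq// mul0r mulr0 addr0.
apply: etrans (polDE hr) _; symmetry.
apply: etrans (congr2 (fun u v => u * q + p * v) (polDE hp) (polDE hq)) _.
rewrite mulr_suml mulr_sumr -big_split; apply: eq_bigr => x _ /=.
by rewrite [in RHS]pderivM; exact: scale_mul_leibniz.
Qed.

Lemma polD_var x : polD (Z_ x) = x.2.+1%:R *: Z_ (x.1, x.2.+1).
Proof.
rewrite (@polDE [fset x]%fset) ?big_seq_fset1 ?pderiv_var ?eqxx ?mulr1// => y.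
by rewrite inE pderiv_var => /negbTE ->.
Qed.

Lemma polT_spanP (p : pol) :
  polT_pred p <->
  exists s : seq (R * mon), all (fun u => bracket u.2 == 1) s /\
    p = \sum_(u <- s) u.1 *: << u.2 >>.
Proof.
split=> [pT|[s [/allP sT ->]]].
  exists [seq (p@_b, b) | b <- msupp p]; rewrite all_map; split=> //.
  rewrite big_map {1}[p]monalgE; apply: eq_bigr => b _ /=.
  by rewrite malgZU mulr1.
apply/polT_predP; rewrite big_seq; apply: homog_sum => u us.
by apply/homogZ/homogU/eqP/sT.
Qed.

Lemma polT_submod : submod_closed polT_pred.
Proof.
split=> [|r p q /polT_predP hp /polT_predP hq]; apply/polT_predP.
  exact: homog0.
by apply: homogD => //; apply: homogZ.
Qed.

HB.instance Definition _ := GRing.isSubmodClosed.Build R pol polT_pred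
  (GRing.submod_closed_semi polT_submod).
HB.instance Definition _ := [SubChoice_isSubLmodule of polT by <:].

Lemma polT_mulD (p q : polT) : polT_pred (polT_val p * polD (polT_val q)).
Proof.
apply/polT_predP; rewrite -[X in homog X _]/(1 + (1 - 1) : int).
by apply: homogM; [|apply: homog_polD]; apply/polT_predP; apply: valP.
Qed.

Definition polT_mul (p q : polT) : polT := PolT (polT_mulD p q).

Lemma polT_valP r (p q : polT) :
  polT_val (r *: p + q) = r *: polT_val p + polT_val q.
Proof. exact: (linearP (\val : polT -> pol)). Qed.

Lemma polT_valB (p q : polT) : polT_val (p - q) = polT_val p - polT_val q.
Proof. exact: (linearB (\val : polT -> pol)). Qed.

Let mul_linearl q : linear (polT_mul^~ q).
Proof.
move=> r p p'; apply: val_inj; rewrite [RHS]polT_valP [LHS]/=.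
by apply: etrans (congr1 ( *%R^~ _) (polT_valP r p p')) _; exact: mul_linear_l.
Qed.
Let mul_linearr p : linear (polT_mul p).
Proof.
move=> r q q'; apply: val_inj; rewrite [RHS]polT_valP [LHS]/=.
apply: etrans (congr1 (fun u => _ * polD u) (polT_valP r q q')) _.
by apply: etrans (congr1 _ (polD_linear _ _ _)) _; exact: mul_linear_r.
Qed.
Let mul_prelie a b c : polT_mul a (polT_mul b c) - polT_mul (polT_mul a b) c =
  polT_mul b (polT_mul a c) - polT_mul (polT_mul b a) c.
Proof.
apply: val_inj; rewrite [LHS]polT_valB [RHS]polT_valB.
exact: (deriv_prelie polDM).
Qed.
Let mul_rcomm a b c :
  polT_mul (polT_mul a b) c = polT_mul (polT_mul a c) b.
Proof. by apply: val_inj; exact: mulrAC. Qed.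

HB.instance Definition _ := Lmodule_isNovikov.Build R polT
  mul_linearl mul_linearr mul_prelie mul_rcomm.

End NovikovPoly.

(* Main.v *)
Require Import Defs.
From HB Require Import structures.
From mathcomp Require Import all_boot all_algebra.
From mathcomp Require Import reals.
From mathcomp Require Import finmap generic_quotient classical_sets.
From mathcomp Require Import zify ring.
From mathcomp.multinomials Require Import monalg.

(** Why the theorem holds.

    Think of a Novikov algebra [A] as sitting inside a commutative algebra with
    a derivation [D], with [a ▷ b = a * D b]. No such embedding is constructed
    here, but it tells which elements of [A] to look at: for generators
    [x_l] in [A], the product [a x_(y1) ... x_(yk) D^(k+1)(x_l) / (k+1)!] must
    be an element of [A], the value at [a] of an operator [node l s] with
    [s = [:: y1; ...; yk]]. The Leibniz rule for [D (node l s (x_y))] yields a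
    recursion for these operators in terms of [▷] alone ([nodeS]), and the
    recursion is the definition. In [polT], where [x_l] is [z_(l,0)], the
    operator [node l s] is the multiplication by
    [z_(l,k+1) z_(y1,0) ... z_(yk,0)] ([node_val]).

    The key point is that [node] is as commutative as the formula suggests, in
    every Novikov algebra: all the operators [node l s] commute with each other
    ([right_opC]), and [node l s (x_y)] does not change when the letters of
    [y :: s] are permuted ([node_perm], [node_swap]). Right-commutativity gives the first
    claim, since [node l s] lies in the commutative algebra generated by the
    right multiplications. The pre-Lie identity gives the second one: it says
    that [op_deriv p a b], which stands for [a b D(p)], is symmetric in [a] and
    [b] when [p] is a right multiplication, and this extends to the algebra
    that they generate ([op_derivC]).

    Now let a monomial of bracket 1 have the leaves [z_(y0,0)], ...,
    [z_(ym,0)] and the other variables [z_(l,k+1)]; bracket 1 means that the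
    sum of the [k] is [m]. Distributing all the leaves but one over the other
    variables writes the monomial as a composition of [node]s applied to
    [x_(y0)] ([graft]), and by the two commutativities the result in [A] does
    not depend on how this is done ([graft_leaf_perm], [graft_shape_perm]).
    So every choice of generators of [A] yields a linear map
    [polT_eval : polT -> A].

    For the free algebra, let [f] be the morphism to [polT] with
    [fn_gen l |-> z_(l,0)]. It sends a graft to its monomial, so [polT_eval] is
    a right inverse of [f] ([morphK]). It is also a left inverse ([evalK]):
    this is clear on grafts, and the elements obtained from the generators by
    linear combinations and [node]s are closed under [▷] ([node_spanM]), again
    by the recursion and the symmetry of [op_deriv]. *)

Set Implicit Arguments.
Unset Strict Implicit.
Unset Printing Implicit Defensive.

Import GRing.Theory Num.Theory.

Local Open Scope ring_scope.

(** * Permutations of sequences *)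

Lemma adjacent_swap_perm (T : eqType) (Y : Type) (f : seq T -> Y) :
  (forall s1 x y s2, f (s1 ++ x :: y :: s2) = f (s1 ++ y :: x :: s2)) ->
  forall s t, perm_eq s t -> f s = f t.
Proof.
move=> + s; elim: s f => [|x s IHs] f fswap t.
  by rewrite perm_sym => /perm_nilP ->.
move=> st; have xt : x \in t by rewrite -(perm_mem st) mem_head.
case/splitPr: xt st => t1 t2; rewrite perm_sym => st.
have {}st : perm_eq s (t1 ++ t2).
  move: st; rewrite -[t1 ++ x :: t2]/(t1 ++ [:: x] ++ t2) perm_catCA.
  by rewrite perm_cons perm_sym.
have -> : f (t1 ++ x :: t2) = f (x :: t1 ++ t2).
  elim/last_ind: t1 t2 {st} => [|t1 y IHt] t2 //.
  by rewrite !cat_rcons -fswap IHt.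
by apply: (IHs (fun u => f (x :: u))) st => s1 y z s2; rewrite -!cat_cons fswap.
Qed.

Lemma rem_cons_perm (T : eqType) (y z : T) s :
  z \in s -> perm_eq (rem z (y :: s)) (y :: rem z s).
Proof.
move=> zs; rewrite /=; case: eqP => [->|_ //]; exact: perm_to_rem.
Qed.

(** * Right multiplications in a Novikov algebra *)

Section NovikovAlgebra.
Variables (R : numFieldType) (A : novikovType R).
Implicit Types (a b : A) (p q : A -> A).

Lemma novDl a b c : (a + b) ▷ c = a ▷ c + b ▷ c :> A.
Proof. by have := nov_linearl c 1 a b; rewrite !scale1r. Qed.

Lemma nov0l b : 0 ▷ b = 0 :> A.
Proof. by apply: (addrI (0 ▷ b)); rewrite -novDl !addr0. Qed.

Lemma novZl r a b : (r *: a) ▷ b = r *: (a ▷ b).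
Proof. by have := nov_linearl b r a 0; rewrite !addr0 nov0l addr0. Qed.

Lemma novDr a b c : a ▷ (b + c) = a ▷ b + a ▷ c :> A.
Proof. by have := nov_linearr a 1 b c; rewrite !scale1r. Qed.

Lemma nov0r a : a ▷ 0 = 0 :> A.
Proof. by apply: (addrI (a ▷ 0)); rewrite -novDr !addr0. Qed.

Lemma novZr r a b : a ▷ (r *: b) = r *: (a ▷ b).
Proof. by have := nov_linearr a r b 0; rewrite !addr0 nov0r addr0. Qed.

(** The algebra of operators generated by the right multiplications. It is
    commutative by [nov_rcomm], and plays the role of the elements of degree 0
    of a differential algebra that contains [A] in degree 1 and in which [D]
    lowers the degree by 1. *)
Inductive right_op : (A -> A) -> Prop :=
| RightOp_mul c : right_op (fun a => a ▷ c)
| RightOp_id : right_op id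
| RightOp_zero : right_op (fun=> 0)
| RightOp_add p q : right_op p -> right_op q -> right_op (fun a => p a + q a)
| RightOp_scale r p : right_op p -> right_op (fun a => r *: p a)
| RightOp_comp p q : right_op p -> right_op q -> right_op (fun a => p (q a))
| RightOp_ext p q : p =1 q -> right_op p -> right_op q.

Lemma right_opD p a b : right_op p -> p (a + b) = p a + p b.
Proof.
move=> rp; elim: rp a b => {p} [c|||p q _ IHp _ IHq|r p _ IHp
  |p q _ IHp _ IHq|p q pq _ IHp] a b //=.
- exact: novDl.
- by rewrite addr0.
- by rewrite IHp IHq addrACA.
- by rewrite IHp scalerDr.
- by rewrite IHq IHp.
- by rewrite -!pq.
Qed.

Lemma right_opZ p r a : right_op p -> p (r *: a) = r *: p a.
Proof.
move=> rp; elim: rp r a => {p} [c|||p q _ IHp _ IHq|k p _ IHp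
  |p q _ IHp _ IHq|p q pq _ IHp] r a //=.
- exact: novZl.
- by rewrite scaler0.
- by rewrite IHp IHq scalerDr.
- by rewrite IHp !scalerA mulrC.
- by rewrite IHq IHp.
- by rewrite -!pq.
Qed.

Lemma right_opN p a : right_op p -> p (- a) = - p a.
Proof. by move=> rp; rewrite -scaleN1r right_opZ// scaleN1r. Qed.

Lemma right_opB p a b : right_op p -> p (a - b) = p a - p b.
Proof. by move=> rp; rewrite right_opD// right_opN. Qed.

Lemma right_op0 p : right_op p -> p 0 = 0.
Proof. by move=> rp; have := right_opZ 0 0 rp; rewrite !scale0r. Qed.

Lemma right_op_bigsum (I : eqType) (s : seq I) (F : I -> A -> A) :
  {in s, forall i, right_op (F i)} -> right_op (fun a => \sum_(i <- s) F i a).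
Proof.
elim: s => [|i s IHs] rF.
  by apply: RightOp_ext RightOp_zero => a; rewrite big_nil.
have rs : right_op (fun a => \sum_(i <- s) F i a).
  by apply: IHs => j js; apply: rF; rewrite inE js orbT.
apply: RightOp_ext (RightOp_add (rF i (mem_head _ _)) rs) => a.
by rewrite big_cons.
Qed.

Lemma right_opM p a b : right_op p -> p (a ▷ b) = p a ▷ b.
Proof.
move=> rp; elim: rp a b => {p} [c|||p q _ IHp _ IHq|k p _ IHp
  |p q _ IHp _ IHq|p q pq _ IHp] a b //=.
- exact: nov_rcomm.
- by rewrite nov0l.
- by rewrite IHp IHq novDl.
- by rewrite IHp novZl.
- by rewrite IHq IHp.
- by rewrite -!pq.
Qed.

Lemma right_opC p q a : right_op p -> right_op q -> p (q a) = q (p a).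
Proof.
move=> rp rq; elim: rp a => {p} [c|||p p' _ IHp _ IHq|k p _ IHp
  |p p' _ IHp _ IHq|p p' pq _ IHp] a //=.
- by rewrite right_opM.
- by rewrite right_op0.
- by rewrite IHp IHq right_opD.
- by rewrite IHp right_opZ.
- by rewrite IHq IHp.
- by rewrite -!pq.
Qed.

(** If [p] is the multiplication by an element of a differential algebra, then
    this is [a * b * D p], by the Leibniz rule. *)
Definition op_deriv p a b : A := a ▷ p b - p (a ▷ b).

Lemma op_derivM p q a b : right_op p -> right_op q ->
  op_deriv p (q a) b = q (op_deriv p a b).
Proof.
move=> rp rq; rewrite /op_deriv right_opB// (right_opC _ rq rp).
by rewrite !(right_opM _ _ rq).
Qed.

(** For right multiplications this is the pre-Lie identity. It passes to
    compositions because [a b D(pq) = a (q b) D p + p (a b D q)], and the first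
    summand is [q (a b D p)] by [op_derivM] and the symmetry of [op_deriv p]. *)
Lemma op_derivC p a b : right_op p -> op_deriv p a b = op_deriv p b a.
Proof.
move=> rp; elim: rp a b => {p} [c|||p q _ IHp _ IHq|r p _ IHp
  |p q rp IHp rq IHq|p q pq _ IHp] a b.
- exact: nov_prelie.
- by rewrite /op_deriv !subrr.
- by rewrite /op_deriv !nov0r.
- rewrite /op_deriv !novDr.
  have := congr2 +%R (IHp a b) (IHq a b).
  by rewrite /op_deriv !opprD addrACA => ->; rewrite addrACA.
- by rewrite /op_deriv !novZr -!scalerBr -!/(op_deriv _ _ _) IHp.
- have comp c d : op_deriv (fun a => p (q a)) c d
      = op_deriv p c (q d) + p (op_deriv q c d).
    by rewrite /op_deriv right_opB// addrA subrK.
  rewrite !comp (IHq a) (IHp a) (IHp b (q a)).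
  by rewrite (op_derivM a b rp rq) (op_derivM b a rp rq) (IHp a).
- by rewrite /op_deriv -!pq; exact: IHp.
Qed.

(** * The operators [a |-> a x_(y1) ... x_(yk) D^(k+1)(x_l) / (k+1)!] *)

Section Nodes.
Variables (L : eqType) (x : L -> A).
Implicit Types (l y z : L) (s t : seq L) (sh : seq (L * nat)).

(** With [n = size s]: [rem z s] is not structurally smaller than [s]. *)
Fixpoint node_rec n l s a : A :=
  match n, s with
  | n'.+1, y :: s' => n.+1%:R^-1 *: (a ▷ node_rec n' l s' (x y) -
      \sum_(z <- s) node_rec n' l (rem z s) (a ▷ x z))
  | _, _ => a ▷ x l
  end.

(** The element [a * x_(y1) * ... * x_(yk) * D^(k+1)(x_l) / (k+1)!] for
    [s = [:: y1; ...; yk]]. *)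
Definition node l s a : A := node_rec (size s) l s a.

Lemma node0 l a : node l [::] a = a ▷ x l.
Proof. by []. Qed.

(** The Leibniz rule for [a * D (x_y x_s D^(k+1)(x_l))], solved for the term in
    which [D^(k+1)(x_l)] is differentiated. *)
Lemma nodeS l y s a : (size s).+2%:R *: node l (y :: s) a =
  a ▷ node l s (x y) - \sum_(z <- y :: s) node l (rem z (y :: s)) (a ▷ x z).
Proof.
rewrite /node [node_rec _ _ (y :: s) a]/= scalerA divff ?pnatr_eq0// scale1r.
congr (_ - _); apply: eq_big_seq => z zs.
by rewrite (size_rem zs).
Qed.

Lemma right_op_node l s : right_op (node l s).
Proof.
have [n] := ubnP (size s); elim: n s => // n IHn [_|y s /= sn].
  exact: RightOp_mul.
have rec z : z \in y :: s ->
    right_op (fun a => node l (rem z (y :: s)) (a ▷ x z)).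
  move=> zs; apply: RightOp_comp (RightOp_mul _).
  by apply: IHn; rewrite (size_rem zs).
apply: RightOp_ext (RightOp_scale (size s).+2%:R^-1 (RightOp_add
  (RightOp_mul (node l s (x y)))
  (RightOp_scale (-1) (right_op_bigsum rec)))) => a /=.
by rewrite scaleN1r -nodeS scalerK// pnatr_eq0.
Qed.

Local Hint Resolve right_op_node : core.

(** The summand [z = y] of [nodeS] completes the first term to an [op_deriv];
    in this form the symmetry in [a] and [x y] can be read off. *)
Lemma nodeS_deriv l y s a : (size s).+2%:R *: node l (y :: s) a =
  op_deriv (node l s) a (x y) - \sum_(z <- s) node l (rem z (y :: s)) a ▷ x z.
Proof.
rewrite nodeS big_cons opprD addrA [rem y _]/= eqxx; congr (_ - _).
by apply: eq_bigr => z _; rewrite right_opM.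
Qed.

Let perm_at l n := forall s t,
  size s = n -> perm_eq s t -> node l s =1 node l t.
Let swap_at l n := forall s y z, (size s).+1 = n ->
  node l (y :: s) (x z) = node l (z :: s) (x y).

Let perm_leaf_at l n s t y z : perm_at l n -> swap_at l n -> size s = n ->
  perm_eq (y :: s) (z :: t) -> node l s (x y) = node l t (x z).
Proof.
move=> permn swapn sn; have [->|yz] := eqVneq y z.
  by rewrite perm_cons => /(permn _ _ sn) ->.
move=> st; have zs : z \in s.
  by have := mem_head z t; rewrite -(perm_mem st) inE eq_sym (negbTE yz).
have szt : perm_eq s (z :: rem z s) := perm_to_rem zs.
have yt : perm_eq (y :: rem z s) t.
  rewrite -(perm_cons z) -(permPr st) -[z :: _]/([:: z] ++ [:: y] ++ rem z s).
  by rewrite perm_catCA /= perm_cons perm_sym.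
have tn : size (y :: rem z s) = n.
  by rewrite -sn /= size_rem// prednK//; case: (s) zs.
by rewrite (permn _ _ sn szt) swapn// (permn _ _ tn yt).
Qed.

(** Both symmetries are proved together. In [nodeS] the first term and the sum
    are invariant under permutations of [y :: s] by induction, while
    [nodeS_deriv] and [op_derivC] exchange [y] with the letter of the argument;
    the two generate all permutations. *)
Let node_sym l n : perm_at l n /\ swap_at l n.
Proof.
elim: n => [|n [IHp IHc]].
  by split=> // u v /size0nil ->; rewrite perm_sym => /perm_nilP ->.
have nz m : m.+2%:R != 0 :> R by rewrite pnatr_eq0.
split=> [[|a u] // [|b v]|u a b [un]].
- by move=> _ /perm_size.
- move=> [un] uv c; apply: (scalerI (nz (size u))).
  have vu : size v = size u by have /perm_size [] := uv.
  rewrite nodeS -[in RHS]vu nodeS (perm_leaf_at IHp IHc un uv) (perm_big _ uv).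
  congr (_ - _); apply: eq_big_seq => z zv.
  have zu : z \in a :: u by rewrite (perm_mem uv).
  apply: IHp; first by rewrite (size_rem zu).
  rewrite -(perm_cons z).
  by rewrite -(permPl (perm_to_rem zu)) -(permPr (perm_to_rem zv)).
apply: (scalerI (nz (size u))).
rewrite !nodeS_deriv op_derivC//; congr (_ - _).
apply: eq_big_seq => z zu; congr (_ ▷ _).
have szu c : size (rem z (c :: u)) = n by rewrite size_rem ?inE ?zu ?orbT.
rewrite (IHp _ _ (szu a) (rem_cons_perm a zu)).
rewrite (IHp _ _ (szu b) (rem_cons_perm b zu)).
by apply: IHc; rewrite size_rem// un prednK// -un; case: (u) zu.
Qed.

Lemma node_perm l s t : perm_eq s t -> node l s =1 node l t.
Proof. by case: (node_sym l (size s)) => h _; apply: h. Qed.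

Lemma node_swap l s y z : node l (y :: s) (x z) = node l (z :: s) (x y).
Proof. by case: (node_sym l (size s).+1) => _; apply. Qed.

(** * Monomials as compositions of nodes *)

(** The letters of [s] are dealt out to the nodes of [sh], where [(l, k)] is a
    node with label [l] that takes [k] of them. If [s] is too long the value is
    0, so that [graft_swap] holds without a condition on the size of [s]. *)
Fixpoint graft sh a s : A :=
  if sh is (l, k) :: sh' then node l (take k s) (graft sh' a (drop k s))
  else if nilp s then a else 0.

Lemma right_op_graft sh s : right_op (fun a => graft sh a s).
Proof.
elim: sh s => [|[l k] sh IHsh] s /=; last exact: RightOp_comp.
by case: (nilp s); [exact: RightOp_id|exact: RightOp_zero].
Qed.

(** The node commutes with those of [sh], so it can be brought next to the
    innermost letter. *)
Lemma node_graft_swap sh l s t y z :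
  node l (y :: s) (graft sh (x z) t) = node l (z :: s) (graft sh (x y) t).
Proof.
elim: sh t => [|[m k] sh IHsh] t /=.
  case: ifP => _; first exact: node_swap.
  by rewrite !(right_op0 (right_op_node _ _)).
rewrite !(right_opC _ (right_op_node l _) (right_op_node m _)).
by rewrite IHsh.
Qed.

Lemma graft_swap sh s t y z :
  graft sh (x z) (s ++ y :: t) = graft sh (x y) (s ++ z :: t).
Proof.
elim: sh s => [|[l k] sh IHsh] s /=; first by case: s.
rewrite !take_cat !drop_cat; case: ltnP => // sk; first exact: congr1.
case: (k - size s)%N => [|n] /=; first by rewrite cats0 (IHsh [::]).
have toy u : perm_eq (s ++ u :: take n t) (u :: s ++ take n t).
  by rewrite -cat1s perm_catCA.
by rewrite !(node_perm l (toy _)) node_graft_swap.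
Qed.

(** The exchanges of the innermost letter with another one generate all
    permutations: three of them exchange two neighbours in [s]. *)
Lemma graft_leaf_perm sh s t y z : perm_eq (y :: s) (z :: t) ->
  graft sh (x y) s = graft sh (x z) t.
Proof.
pose f u := if u is w :: v then graft sh (x w) v else 0.
apply: (adjacent_swap_perm (f := f)) => [[|w s1] v u s2] /=.
  exact: (graft_swap sh [::]).
(* (v u) = (w v) (w u) (w v) *)
rewrite (graft_swap sh s1 _ v w) -cat_rcons (graft_swap sh _ s2 u v) cat_rcons.
by rewrite (graft_swap sh s1 _ w u).
Qed.

Definition total_arity sh := sumn [seq v.2 | v <- sh].

(** Exchanging two neighbouring nodes together with their blocks of letters
    does nothing, as nodes commute; the letters are then put back in order by
    [graft_leaf_perm]. *)
Lemma graft_shape_perm sh sh' y s : size s = total_arity sh -> perm_eq sh sh' ->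
  graft sh (x y) s = graft sh' (x y) s.
Proof.
move=> ssh shsh'; have /eqP ssh' : size s == total_arity sh'.
  by rewrite ssh /total_arity; apply/eqP/perm_sumn/perm_map.
(* Only the sequences of nodes that match the size of [s] matter. *)
pose f u := if size s == total_arity u then graft u (x y) s else 0.
suff : f sh = f sh' by rewrite /f ssh eqxx -ssh ssh' eqxx.
apply: (adjacent_swap_perm (f := f)) shsh' => {ssh ssh'} sh1 [l k] [l' k'] sh2.
rewrite /f /total_arity !map_cat !sumn_cat /= (addnCA k); case: eqP => // ss.
elim: sh1 s {f} ss => [|[m i] sh1 IHsh] s /= ss; last first.
  by apply: congr1; apply: IHsh; rewrite size_drop ss -addnA addKn.
(* [a] and [b] are the blocks of the two nodes. *)
set c := drop k' (drop k s); set b := take k' (drop k s); set a := take k s.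
have sabc : s = a ++ b ++ c by rewrite !cat_take_drop.
have [sa sb] : size a = k /\ size b = k'.
  by rewrite !size_takel ?size_drop; lia.
rewrite -[RHS]/(graft [:: (l', k'), (l, k) & sh2] (x y) s).
have -> : graft [:: (l', k'), (l, k) & sh2] (x y) s =
    graft [:: (l', k'), (l, k) & sh2] (x y) (b ++ a ++ c).
  by apply: graft_leaf_perm; rewrite perm_cons sabc perm_catCA.
rewrite /= take_size_cat// drop_size_cat// take_size_cat// drop_size_cat//.
exact: right_opC.
Qed.

Lemma graft_node sh l s t a : size s = total_arity sh ->
  graft sh (node l t a) s = graft (rcons sh (l, size t)) a (s ++ t).
Proof.
elim: sh s => [|[m k] sh IHsh] s /= ss.
  by rewrite (size0nil ss) /= take_size drop_size.
have sk : (k <= size s)%N by rewrite ss leq_addr.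
rewrite IHsh ?size_drop ?ss ?addKn// take_cat drop_cat.
move: sk; rewrite leq_eqVlt => /orP[/eqP ->|->//].
by rewrite ltnn subnn take0 drop0 take_size drop_size cats0.
Qed.

(** * The span of the compositions of nodes *)

Inductive node_span : A -> Prop :=
| NodeSpan_gen y : node_span (x y)
| NodeSpan_zero : node_span 0
| NodeSpan_add a b : node_span a -> node_span b -> node_span (a + b)
| NodeSpan_scale r a : node_span a -> node_span (r *: a)
| NodeSpan_node l s a : node_span a -> node_span (node l s a).

Lemma node_span_gen a y : node_span a -> node_span (a ▷ x y).
Proof. by rewrite -node0; exact: NodeSpan_node. Qed.

(** [op_deriv (node l s) a (x y)] is a combination of nodes by [nodeS_deriv];
    nodes in [b] can be moved out because [op_deriv] is linear over [right_op]
    in each argument. *)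
Lemma node_span_deriv l s a b : node_span a -> node_span b ->
  node_span (op_deriv (node l s) a b).
Proof.
have rp := right_op_node l s.
move=> ha; elim=> {b} [y||b c _ hb _ hc|r b _ hb|m t b _ hb].
- rewrite -[X in node_span X](subrK
    (\sum_(z <- s) node l (rem z (y :: s)) a ▷ x z)).
  rewrite -nodeS_deriv; apply: NodeSpan_add.
    exact/NodeSpan_scale/NodeSpan_node.
  elim/big_ind: _ => [||z _]; [exact: NodeSpan_zero|exact: NodeSpan_add|].
  exact/node_span_gen/NodeSpan_node.
- rewrite /op_deriv (right_op0 rp) nov0r (right_op0 rp) subrr.
  exact: NodeSpan_zero.
- rewrite /op_deriv (right_opD _ _ rp) !novDr (right_opD _ _ rp) opprD addrACA.
  exact: NodeSpan_add.
- rewrite /op_deriv (right_opZ _ _ rp) !novZr (right_opZ _ _ rp) -scalerBr.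
  exact: NodeSpan_scale.
- rewrite op_derivC// op_derivM// op_derivC//; exact: NodeSpan_node.
Qed.

(** The Leibniz rule reads [a ▷ p b = p (a ▷ b) + a b D(p)]. *)
Lemma node_spanM a b : node_span a -> node_span b -> node_span (a ▷ b).
Proof.
move=> ha; elim=> {b} [y||b c _ hb _ hc|r b _ hb|l s b hb hab].
- exact: node_span_gen.
- by rewrite nov0r; exact: NodeSpan_zero.
- by rewrite novDr; exact: NodeSpan_add.
- by rewrite novZr; exact: NodeSpan_scale.
rewrite -(subrK (node l s (a ▷ b)) (a ▷ _)); apply: NodeSpan_add.
  exact: node_span_deriv.
exact: NodeSpan_node.
Qed.

End Nodes.
End NovikovAlgebra.

(** * Nodes and Novikov morphisms *)

Section Morphism.
Variables (R : numFieldType) (A B : novikovType R) (f : {linear A -> B}).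
Hypothesis fM : novikov_morph f.
Variables (L : eqType) (x : L -> A) (y : L -> B).
Hypothesis fx : forall l, f (x l) = y l.

Lemma morph_node l s a : f (node x l s a) = node y l s (f a).
Proof.
have [n] := ubnP (size s); elim: n s a => // n IHn [|w s] a sn.
  by rewrite !node0 fM fx.
have nz : (size s).+2%:R != 0 :> R by rewrite pnatr_eq0.
apply: (scalerI nz); rewrite -linearZ !nodeS linearB linear_sum fM IHn// fx.
congr (_ - _); apply: eq_big_seq => z zs.
have sz : size (rem z (w :: s)) = size s by rewrite (size_rem zs).
by rewrite IHn ?sz// fM fx.
Qed.

Lemma morph_graft sh a s : f (graft x sh a s) = graft y sh (f a) s.
Proof.
elim: sh s => [|[l k] sh IHsh] s /=.
  by case: ifP => // _; rewrite linear0.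
by rewrite morph_node IHsh.
Qed.
End Morphism.

(** * Nodes in a differential algebra *)

(** With [s = y :: s'], these are the variables of the monomial of the graft
    [graft sh (x y) s']: a node that takes [k] letters has the index [k+1], as
    it also multiplies the element to which it is applied. *)
Definition graft_word (L : Type) (sh : seq (L * nat)) (s : seq L) :
    seq (L * nat) :=
  [seq (v.1, v.2.+1) | v <- sh] ++ [seq (y, 0%N) | y <- s].

Section LinearFunctions.
Variables (R : nzRingType) (U V : lmodType R) (f : U -> V).
Hypothesis f_linear : linear f.

Lemma linear_fun0 : f 0 = 0.
Proof.
by have := f_linear (-1) 0 0; rewrite !scaleN1r oppr0 addr0 addNr.
Qed.

Lemma linear_funD u v : f (u + v) = f u + f v.
Proof. by have := f_linear 1 u v; rewrite !scale1r. Qed.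

Lemma linear_funZ r u : f (r *: u) = r *: f u.
Proof. by have := f_linear r u 0; rewrite linear_fun0 !addr0. Qed.

Lemma linear_fun_sum (I : Type) (s : seq I) (u : I -> U) :
  f (\sum_(i <- s) u i) = \sum_(i <- s) f (u i).
Proof.
elim/big_rec2: _ => [|i v w _ <-]; first exact: linear_fun0.
exact: linear_funD.
Qed.
End LinearFunctions.

Section Derivation.
Variables (R : numFieldType) (B : comAlgType R) (D : B -> B).
Hypothesis DM : forall p q, D (p * q) = D p * q + p * D q.
Variables (L : eqType) (z : L -> nat -> B).
Hypothesis Dz : forall l k, D (z l k) = k.+1%:R *: z l k.+1.

Definition leaf_prod s : B := \prod_(y <- s) z y 0.

Lemma deriv_leaf_prod s :
  D (leaf_prod s) = \sum_(w <- s) D (z w 0) * leaf_prod (rem w s).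
Proof.
rewrite /leaf_prod; elim: s => [|y s IHs].
  rewrite !big_nil; apply: (addIr (D 1)); rewrite add0r.
  by have := DM 1 1; rewrite !mulr1 mul1r => <-.
rewrite !big_cons DM IHs [rem y _]/= eqxx mulr_sumr; congr (_ + _).
apply: eq_big_seq => w ws.
by rewrite (perm_big _ (rem_cons_perm y ws)) big_cons mulrCA.
Qed.

(** The product [a * z_(l,k+1) * z_(y1,0) * ... * z_(yk,0)] satisfies the
    recursion [nodeS]. *)
Lemma deriv_node_rec l y s a :
  a * D (z y 0 * (z l (size s).+1 * leaf_prod s)) -
    \sum_(w <- y :: s)
      a * D (z w 0) * (z l (size s).+1 * leaf_prod (rem w (y :: s))) =
  (size s).+2%:R *: (a * (z l (size s).+2 * leaf_prod (y :: s))).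
Proof.
have -> : z y 0 * (z l (size s).+1 * leaf_prod s) =
    z l (size s).+1 * leaf_prod (y :: s).
  by rewrite mulrCA [leaf_prod (y :: s)]big_cons.
rewrite DM deriv_leaf_prod Dz mulrDr mulr_sumr mulr_sumr.
rewrite -scalerAl -scalerAr -addrA [X in _ + X](_ : _ = 0) ?addr0//.
apply/eqP; rewrite subr_eq0; apply/eqP; apply: eq_bigr => w _.
by rewrite -!mulrA; congr (_ * _); rewrite mulrCA.
Qed.

(** The case in mind is the inclusion [v] of [A = polT] in the polynomials. *)
Variables (A : novikovType R) (v : A -> B) (x : L -> A).
Hypothesis v_linear : linear v.
Hypothesis vM : forall a b, v (a ▷ b) = v a * D (v b).
Hypothesis vx : forall l, v (x l) = z l 0.

Lemma node_val l s a : v (node x l s a) = v a * (z l (size s).+1 * leaf_prod s).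
Proof.
have [n] := ubnP (size s); elim: n s a => // n IHn [|y s] a sn.
  by rewrite node0 /leaf_prod big_nil mulr1 vM vx Dz scale1r.
have nz : (size s).+2%:R != 0 :> R by rewrite pnatr_eq0.
apply: (scalerI nz); rewrite -(linear_funZ v_linear) -deriv_node_rec nodeS.
rewrite -scaleN1r addrC v_linear scaleN1r addrC (linear_fun_sum v_linear).
rewrite vM IHn// vx; congr (_ - _); apply: eq_big_seq => w ws.
have sw : size (rem w (y :: s)) = size s by rewrite (size_rem ws).
by rewrite IHn ?sw// vM vx.
Qed.

Lemma graft_val sh a s : size s = total_arity sh ->
  v (graft x sh a s) = v a * (\prod_(u <- sh) z u.1 u.2.+1 * leaf_prod s).
Proof.
elim: sh s => [|[l k] sh IHsh] s ss.
  by rewrite (size0nil ss) /leaf_prod !big_nil !mulr1.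
have sk : (k <= size s)%N by rewrite ss leq_addr.
rewrite [graft _ _ _ _]/(node x l (take k s) (graft x sh a (drop k s))).
rewrite node_val IHsh ?size_drop ?ss ?addKn// -mulrA size_takel//.
rewrite -{3}(cat_take_drop k s) /leaf_prod big_cat big_cons /=.
by apply: congr1; ring.
Qed.

Lemma graft_gen_val sh y s : size s = total_arity sh ->
  v (graft x sh (x y) s) = \prod_(u <- graft_word sh (y :: s)) z u.1 u.2.
Proof.
move=> ss; rewrite graft_val// vx /graft_word big_cat /= big_cons !big_map.
by rewrite /leaf_prod mulrCA.
Qed.
End Derivation.

(** * Monomials as words *)

Section Polynomials.
Variables (R : comNzRingType) (L : choiceType).

Local Notation var := (L * nat)%type.
Local Notation mon := {cmonom var}.
Local Notation pol := {malg R[mon]}.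
Local Notation T := (polT R L).
Local Notation "'Z_' x" := (<< ucm x >> : pol) (at level 8, x at level 2).

Lemma polT_pred_leaf (l : L) : polT_pred (Z_ (l, 0%N)).
Proof. by apply/polT_predP; apply: homogU; rewrite bracketU subr0. Qed.

Definition leaf (l : L) : T := PolT (polT_pred_leaf l).

Lemma polT_valZ r (p : T) : polT_val (r *: p) = r *: polT_val p.
Proof. exact: (linear_funZ (@polT_valP R L)). Qed.

Lemma polT_val_sum (I : Type) (s : seq I) (F : I -> T) :
  polT_val (\sum_(i <- s) F i) = \sum_(i <- s) polT_val (F i).
Proof. exact: (linear_fun_sum (@polT_valP R L)). Qed.

Definition word_mon (w : seq var) : mon :=
  foldr (fun v m => mmul (ucm v) m) mone w.

Lemma word_monE w v : word_mon w v = count_mem v w.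
Proof.
elim: w => [|u w IHw] /=; first exact: onecmE.
by rewrite cmM ucmE IHw.
Qed.

Lemma word_mon_perm w w' : word_mon w = word_mon w' -> perm_eq w w'.
Proof.
by move=> ww'; apply/allP => v _ /=; rewrite -!word_monE ww'.
Qed.

Lemma word_mon_prod w : (<< word_mon w >> : pol) = \prod_(v <- w) Z_ (v.1, v.2).
Proof.
elim: w => [|[l k] w IHw]; first by rewrite big_nil.
by rewrite big_cons -IHw [RHS]malgUU mulr1.
Qed.

Definition graft_mon sh y s : mon := word_mon (graft_word sh (y :: s)).

(** The leaves are recovered as the variables with second index 0. *)
Lemma graft_word_perm (sh sh' : seq var) (s s' : seq L) :
  perm_eq (graft_word sh s) (graft_word sh' s') ->
  perm_eq sh sh' /\ perm_eq s s'.
Proof.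
have isleaf r t : [seq u <- graft_word r t | u.2 == 0%N] =
    [seq (y, 0%N) | y <- t].
  rewrite filter_cat !filter_map /= filter_pred0 /=.
  by rewrite (eq_filter (a2 := predT)) ?filter_predT.
have isnode r t : [seq u <- graft_word r t | u.2 != 0%N] =
    [seq (u.1, u.2.+1) | u <- r].
  rewrite filter_cat !filter_map /= filter_pred0 cats0.
  by rewrite (eq_filter (a2 := predT)) ?filter_predT.
move=> h; split.
  have := perm_filter (fun u => u.2 != 0%N) h; rewrite !isnode => /perm_map_inj.
  by apply=> -[a i] [b j] /= [-> ->].
have := perm_filter (fun u => u.2 == 0%N) h; rewrite !isleaf => /perm_map_inj.
by apply=> a b [->].
Qed.

Lemma bracket_word w : bracket (word_mon w) = \sum_(v <- w) (1 - v.2%:Z).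
Proof.
elim: w => [|v w IHw]; last by rewrite big_cons bracketM bracketU IHw.
by rewrite big_nil /bracket mdom1 big_seq_fset0.
Qed.

Lemma bracket_graft_word sh s :
  bracket (word_mon (graft_word sh s)) = (size s)%:Z - (total_arity sh)%:Z.
Proof.
rewrite bracket_word big_cat !big_map /= addrC.
elim: s => [|y s IHs]; last by rewrite big_cons /= -addrA IHs; lia.
rewrite big_nil; elim: sh => [|v sh IHsh]; first by rewrite big_nil.
by rewrite big_cons /=; move: IHsh; rewrite /total_arity /=; lia.
Qed.

Lemma mon_wordP (b : mon) : exists w, word_mon w = b.
Proof.
exists (flatten [seq nseq (b v) v | v <- finsupp b]).
apply/eqP/cmP => v; rewrite word_monE count_flatten -map_comp sumnE big_map /=.
under eq_bigr do rewrite count_nseq /=.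
have [vb|vb] := boolP (v \in finsupp b).
  rewrite (bigD1_seq v) ?fset_uniq//= eqxx mul1n big1 ?addn0// => u.
  by move=> /negbTE ->.
rewrite big_seq big1 => [|u ub]; first by move: vb; rewrite -cmE_eq0 => /eqP.
by case: eqP vb => // <-; rewrite ub.
Qed.

Lemma word_graft_word (w : seq var) : exists sh s, perm_eq w (graft_word sh s).
Proof.
elim: w => [|[l [|k]] w [sh [s ws]]]; first by exists [::], [::].
  exists sh, (l :: s); rewrite perm_sym /graft_word /=.
  rewrite -[(l, 0%N) :: map _ _]cat1s perm_catCA /= perm_cons perm_sym.
  exact: ws.
by exists ((l, k) :: sh), s; rewrite /= perm_cons.
Qed.

Lemma perm_word_mon w w' : perm_eq w w' -> word_mon w = word_mon w'.
Proof. by move=> /permP ww'; apply/eqP/cmP => v; rewrite !word_monE ww'. Qed.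

(** Bracket 1 says that there is one leaf more than the nodes take. *)
Lemma bracket1_graft (b : mon) : bracket b = 1 ->
  exists sh y s, size s = total_arity sh /\ graft_mon sh y s = b.
Proof.
have [w <-] := mon_wordP b; have [sh [s ws]] := word_graft_word w.
rewrite (perm_word_mon ws) bracket_graft_word.
case: s ws => [|y s] _ hs; first by move: hs => /=; lia.
by exists sh, y, s; split=> //; move: hs => /=; lia.
Qed.

End Polynomials.

(** * Nodes in the polynomial Novikov algebra *)

Section Grafts.
Variables (R : numFieldType) (L : choiceType).

Local Notation var := (L * nat)%type.
Local Notation mon := {cmonom var}.
Local Notation pol := {malg R[mon]}.
Local Notation T := (polT R L).
Local Notation "'Z_' x" := (<< ucm x >> : pol) (at level 8, x at level 2).
Local Notation graft_mon := (@graft_mon L).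
Local Notation leaf := (@leaf R L).

Lemma graft_leafE sh y s : size s = total_arity sh ->
  polT_val (graft leaf sh (leaf y) s) = << graft_mon sh y s >>.
Proof.
move=> ss; rewrite /graft_mon word_mon_prod.
exact: (@graft_gen_val R pol (@polD R L) (@polDM R L) L (fun l k => Z_ (l, k))
  (fun l k => polD_var R (l, k)) T (@polT_val R L) leaf (@polT_valP R L)
  (fun a b => erefl) (fun l => erefl) sh y s ss).
Qed.
End Grafts.

(** * Induction on the free Novikov algebra *)

Section Induction.
Variables (R : comNzRingType) (S : Type).
Local Open Scope quotient_scope.
Local Notation N := (freeNovikov R S).

Lemma freeNovikov_ind (P : N -> Prop) :
  (forall s, P (fn_gen R s)) -> P 0 ->
  (forall a b, P a -> P b -> P (a + b)) ->
  (forall r a, P a -> P (r *: a)) ->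
  (forall a b, P a -> P b -> P (a ▷ b)) ->
  forall a, P a.
Proof.
have rep (t : nterm R S) : nov_eq (repr (\pi_N t)) t.
  by apply/fn_piP; rewrite reprK.
have piD (t u : nterm R S) : \pi_N t + \pi_N u = \pi_N (NAdd t u).
  by rewrite -[LHS]/(Defs.fn_add _ _) /Defs.fn_add -lock; apply/fn_piP/NE_add.
have piN (t : nterm R S) : - \pi_N t = \pi_N (NOpp t).
  by rewrite -[LHS]/(Defs.fn_opp _) /Defs.fn_opp -lock; apply/fn_piP/NE_opp.
have piZ r (t : nterm R S) : r *: \pi_N t = \pi_N (NScale r t).
  rewrite -[LHS]/(Defs.fn_scale _ _) /Defs.fn_scale -lock.
  exact/fn_piP/NE_scale.
have piM (t u : nterm R S) : \pi_N t ▷ \pi_N u = \pi_N (NMul t u).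
  by rewrite -[LHS]/(Defs.fn_mul _ _) /Defs.fn_mul -lock; apply/fn_piP/NE_mul.
move=> Pgen P0 PD PZ PM.
elim/quotW; elim=> [s||t Pt u Pu|t Pt|r t Pt|t Pt u Pu].
- exact: Pgen.
- exact: P0.
- by rewrite -piD; exact: PD.
- by rewrite -piN -scaleN1r; exact: PZ.
- by rewrite -piZ; exact: PZ.
- by rewrite -piM; exact: PM.
Qed.
End Induction.

(** * Evaluating polynomials in a Novikov algebra *)

Section Evaluation.
Variables (R : numFieldType) (L : choiceType).
Variables (A : novikovType R) (x : L -> A).
Local Notation var := (L * nat)%type.
Local Notation mon := {cmonom var}.
Local Notation pol := {malg R[mon]}.

(** A monomial is the monomial of a graft in many ways, and any of them may be
    chosen, by [mon_val_graft]. *)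
Definition mon_val (b : mon) : A :=
  xget 0 [set a | exists sh y s, [/\ size s = total_arity sh, graft_mon sh y s = b
    & a = graft x sh (x y) s]].

Lemma mon_val_graft sh y s : size s = total_arity sh ->
  mon_val (graft_mon sh y s) = graft x sh (x y) s.
Proof.
move=> ss; apply: xget_unique => [|a [sh' [y' [s' [ss' mm ->]]]]].
  by exists sh, y, s.
have [shsh leaves] := graft_word_perm (word_mon_perm mm).
by rewrite (graft_shape_perm x _ ss' shsh); apply: graft_leaf_perm.
Qed.

Definition pol_val (p : pol) : A := \sum_(b <- msupp p) p@_b *: mon_val b.

Lemma pol_valEw (d : {fset mon}) p : (msupp p `<=` d)%fset ->
  pol_val p = \sum_(b <- d) p@_b *: mon_val b.
Proof.
move=> pd; rewrite /pol_val (big_fset_incl _ pd)//= => b _ bp.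
by rewrite mcoeff_outdom// scale0r.
Qed.

Lemma pol_val_linear : linear pol_val.
Proof.
move=> r p q; set d := (msupp (r *: p + q) `|` (msupp p `|` msupp q))%fset.
rewrite !(@pol_valEw d); first last.
- by rewrite fsubsetUl.
- by rewrite /d fsubsetU// fsubsetUl orbT.
- by rewrite /d fsubsetU// fsubsetUr orbT.
rewrite scaler_sumr -big_split; apply: eq_bigr => b _ /=.
by rewrite mcoeffD mcoeffZ scalerDl scalerA.
Qed.

Lemma pol_valU b : pol_val << b >> = mon_val b.
Proof.
rewrite (@pol_valEw [fset b]%fset) ?msuppU_le// big_seq_fset1.
by rewrite mcoeffUU scale1r.
Qed.

Definition polT_eval (p : polT R L) : A := pol_val (polT_val p).

Lemma polT_eval_linear : linear polT_eval.
Proof.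
move=> r p q; rewrite /polT_eval polT_valP; exact: pol_val_linear.
Qed.

HB.instance Definition _ :=
  GRing.isLinear.Build R (polT R L) A _ polT_eval polT_eval_linear.
End Evaluation.

(** * The isomorphism *)

Section Main.
Variables (R : numFieldType) (L : choiceType).
Local Notation N := (freeNovikov R L).
Local Notation T := (polT R L).
Local Notation gen := (@fn_gen R L).

Variable f : {linear N -> T}.
Hypotheses (fM : novikov_morph f) (fgen : forall l, f (gen l) = leaf R l).

Lemma morph_graft_leaf sh y s : size s = total_arity sh ->
  polT_val (f (graft gen sh (gen y) s)) = << graft_mon sh y s >>.
Proof.
move=> ss; rewrite (morph_graft fM fgen) fgen; exact: graft_leafE.
Qed.

Lemma evalK a : polT_eval gen (f a) = a.
Proof.
(* The property is not visibly inherited by [node l t a] from [a] alone, but a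
   graft on [node l t a] is a graft on [a]. *)
suff evalG : forall sh s, size s = total_arity sh ->
    polT_eval gen (f (graft gen sh a s)) = graft gen sh a s.
  exact: (evalG [::] [::]).
have: node_span gen a.
  elim/freeNovikov_ind: a => *.
  - exact: NodeSpan_gen.
  - exact: NodeSpan_zero.
  - exact: NodeSpan_add.
  - exact: NodeSpan_scale.
  - exact: node_spanM.
elim=> {a} [y||a b _ IHa _ IHb|r a _ IHa|l t a _ IHa] sh s ss.
- by rewrite /polT_eval morph_graft_leaf// pol_valU mon_val_graft.
- by rewrite (right_op0 (right_op_graft _ _ _)) !linear0.
- rewrite (right_opD _ _ (right_op_graft _ _ _)) linearD.
  by rewrite (linear_funD (polT_eval_linear _)) IHa ?IHb.
- rewrite (right_opZ _ _ (right_op_graft _ _ _)) linearZ_LR.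
  by rewrite (linear_funZ (polT_eval_linear _)) IHa.
by rewrite graft_node// IHa// size_cat ss /total_arity map_rcons sumn_rcons.
Qed.

Lemma morphK p : f (polT_eval gen p) = p.
Proof.
apply: val_inj; rewrite /polT_eval /pol_val linear_sum.
apply: etrans (polT_val_sum _ _) _.
rewrite [RHS]monalgE; apply: eq_big_seq => b bp.
have [|sh [y [s [ss <-]]]] := @bracket1_graft L b.
  by apply: homog_supp bp; apply/polT_predP; apply: valP.
by rewrite mon_val_graft// linearZ_LR polT_valZ morph_graft_leaf// malgZU mulr1.
Qed.

Lemma polT_eval_iso : novikov_iso T N.
Proof.
exists (polT_eval gen : {linear T -> N}); split.
  move=> p q; rewrite -[RHS]evalK fM; congr (polT_eval gen (_ ▷ _)).
    by rewrite morphK.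
  by rewrite morphK.
by exists f; [exact: morphK|exact: evalK].
Qed.
End Main.

Theorem lemma3p5 (R : realType) (L : finType) :
  novikov_iso (polT R L) (freeNovikov R L).
Proof.
have [f [fM fgen _]] := free_novikovP (@leaf R L).
exact: polT_eval_iso fM fgen.
Qed.
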